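(* Let $A$ be a real reduced multiring. Let $\mathrm{Sper}(A)$ be the set of multiring morphisms $\sigma:A\to Q_2$, and for $a\in A$ let $\hat a:\mathrm{Sper}(A)\to\{-1,0,1\}$ be $\hat a(\sigma)=\sigma(a)$. Let $\hat A=\{\hat a:a\in A\}\subseteq\{-1,0,1\}^{\mathrm{Sper}(A)}$. Then $(\mathrm{Sper}(A),\hat A)$ is an abstract real spectrum.
   Context: A multiring is a tuple $(R,+,\cdot,-,0,1)$ with $+:R\times R\to\mathcal P(R)\setminus\{\emptyset\}$ satisfying: $z\in x+y\Rightarrow x\in z+(-y)$ and $y\in(-x)+z$; $y\in0+x\iff y=x$; $+$ associative (with $Z+w=\bigcup_{z\in Z}(z+w)$) and commutative; $(R,\cdot,1)$ a commutative monoid; $a0=0$; $c\in a+b\Rightarrow cd\in ad+bd$. A multiring $A$ is real reduced if $1\neq0$ and for all $a,b,c,d\in A$: $a^3=a$; $c\in a+ab^2\Rightarrow c=a$; $c,d\in a^2+b^2\Rightarrow c=d$. A multiring morphism $f$ satisfies $c\in a+b\Rightarrow f(c)\in f(a)+f(b)$, $f(-a)=-f(a)$, $f(0)=0$, $f(ab)=f(a)f(b)$, $f(1)=1$. $Q_2=\{-1,0,1\}$ is the multifield with usual product and sum $0+x=x+0=\{x\}$, $1+1=\{1\}$, $(-1)+(-1)=\{-1\}$, $1+(-1)=(-1)+1=\{-1,0,1\}$. An abstract real spectrum (ARS) is a pair $(X,G)$ such that: (AX1) $X$ is a non-empty set, $G$ is a submonoid of $\{-1,0,1\}^X$ (pointwise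 product) containing the constant functions $-1,0,1$, and $G$ separates points. For $a,b\in G$, $D(a,b)$ is the set of $c\in G$ with, for all $x$: $a(x)c(x)>0$ or $b(x)c(x)>0$ or $c(x)=0$; $D^t(a,b)$ is the set of $c\in G$ with, for all $x$: $a(x)c(x)>0$ or $b(x)c(x)>0$ or ($c(x)=0$ and $b(x)=-a(x)$). (AX2) If $P$ is a submonoid of $G$ with $P\cup-P=G$, $-1\notin P$, $a,b\in P\Rightarrow D(a,b)\subseteq P$, and $ab\in P\cap-P\Rightarrow a\in P\cap-P$ or $b\in P\cap-P$, then there is $x\in X$ with $P=\{a\in G:a(x)\ge0\}$. (AX3) If $p\in D^t(a,q)$ for some $q\in D^t(b,c)$, then $p\in D^t(r,c)$ for some $r\in D^t(a,b)$. *)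

(* Defs.v *)
(* A multiring: the multivalued sum x + y is encoded as the relation
   [madd x y z] meaning z ∈ x + y. *)
Record multiring := MultiRing {
  carrier :> Type;
  madd : carrier -> carrier -> carrier -> Prop;
  mopp : carrier -> carrier;
  mzero : carrier;
  mone : carrier;
  mmul : carrier -> carrier -> carrier;
  madd_nonempty : forall x y, exists z, madd x y z;
  madd_rev : forall x y z, madd x y z -> madd z (mopp y) x /\ madd (mopp x) z y;
  madd_0 : forall x y, madd mzero x y <-> y = x;
  madd_assoc : forall x y w t,
    (exists z, madd x y z /\ madd z w t) <-> (exists z, madd y w z /\ madd x z t);
  madd_comm : forall x y z, madd x y z <-> madd y x z;
  mmul_assoc : forall a b c, mmul a (mmul b c) = mmul (mmul a b) c;
  mmul_comm : forall a b, mmul a b = mmul b a;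
  mmul_1 : forall a, mmul mone a = a;
  mmul_0 : forall a, mmul a mzero = mzero;
  mmul_distr : forall a b c d, madd a b c -> madd (mmul a d) (mmul b d) (mmul c d)
}.

Arguments madd {m}.
Arguments mopp {m}.
Arguments mzero {m}.
Arguments mone {m}.
Arguments mmul {m}.

Definition real_reduced (A : multiring) : Prop :=
  (@mone A) <> mzero /\
  (forall a : A, mmul a (mmul a a) = a) /\
  (forall a b c : A, madd a (mmul a (mmul b b)) c -> c = a) /\
  (forall a b c d : A, madd (mmul a a) (mmul b b) c ->
                       madd (mmul a a) (mmul b b) d -> c = d).

Inductive sgn : Type := Sneg | Szero | Spos.

Definition sgn_mul (x y : sgn) : sgn :=
  match x, y with
  | Szero, _ | _, Szero => Szero
  | Spos, Spos | Sneg, Sneg => Spos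
  | _, _ => Sneg
  end.

Definition sgn_opp (x : sgn) : sgn :=
  match x with Sneg => Spos | Szero => Szero | Spos => Sneg end.

Definition q2add (x y z : sgn) : Prop :=
  match x, y with
  | Szero, _ => z = y
  | _, Szero => z = x
  | Spos, Spos => z = Spos
  | Sneg, Sneg => z = Sneg
  | _, _ => True
  end.

Definition is_morphism_Q2 (A : multiring) (f : A -> sgn) : Prop :=
  (forall a b c : A, madd a b c -> q2add (f a) (f b) (f c)) /\
  (forall a : A, f (mopp a) = sgn_opp (f a)) /\
  f mzero = Szero /\
  (forall a b : A, f (mmul a b) = sgn_mul (f a) (f b)) /\
  f mone = Spos.

Definition Sper (A : multiring) : Type := { f : A -> sgn | is_morphism_Q2 A f }.

Definition hat (A : multiring) (a : A) : Sper A -> sgn :=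
  fun s => proj1_sig s a.

Definition hatA (A : multiring) (g : Sper A -> sgn) : Prop :=
  exists a : A, g = hat A a.

Section ARS.
Variable X : Type.
Variable G : (X -> sgn) -> Prop.

Definition fmul (f g : X -> sgn) : X -> sgn := fun x => sgn_mul (f x) (g x).
Definition fopp (f : X -> sgn) : X -> sgn := fun x => sgn_opp (f x).
Definition fconst (s : sgn) : X -> sgn := fun _ => s.

Definition sgn_ge0 (s : sgn) : Prop := s = Szero \/ s = Spos.

Definition Dset (a b c : X -> sgn) : Prop :=
  G c /\ forall x, sgn_mul (a x) (c x) = Spos \/ sgn_mul (b x) (c x) = Spos \/ c x = Szero.

Definition Dtset (a b c : X -> sgn) : Prop :=
  G c /\ forall x, sgn_mul (a x) (c x) = Spos \/ sgn_mul (b x) (c x) = Spos \/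
                   (c x = Szero /\ b x = sgn_opp (a x)).

Definition AX1 : Prop :=
  inhabited X /\
  (G (fconst Sneg) /\ G (fconst Szero) /\ G (fconst Spos)) /\
  (forall f g, G f -> G g -> G (fmul f g)) /\
  (forall x y : X, x <> y -> exists g, G g /\ g x <> g y).

Definition AX2 : Prop :=
  forall P : (X -> sgn) -> Prop,
    (forall f, P f -> G f) ->
    P (fconst Spos) ->
    (forall f g, P f -> P g -> P (fmul f g)) ->
    (forall g, G g <-> (P g \/ P (fopp g))) ->
    ~ P (fconst Sneg) ->
    (forall a b, P a -> P b -> forall c, Dset a b c -> P c) ->
    (forall a b, G a -> G b -> P (fmul a b) /\ P (fopp (fmul a b)) ->
       (P a /\ P (fopp a)) \/ (P b /\ P (fopp b))) ->
    exists x : X, forall g, P g <-> (G g /\ sgn_ge0 (g x)).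

Definition AX3 : Prop :=
  forall a b c p, G a -> G b -> G c ->
    (exists q, Dtset b c q /\ Dtset a q p) ->
    exists r, Dtset a b r /\ Dtset r c p.

Definition is_ARS : Prop := AX1 /\ AX2 /\ AX3.
End ARS.

(* Main.v *)
(** The preorderings of a real reduced multiring [A] include the set [E] of its
idempotents. By Zorn's lemma, a preordering avoiding [- e], with [e] in [E], lies below
some [s] in [Sper A] with [s e = 1]. An algebraic argument improves this to a
Nichtnegativstellensatz without denominators: every preordering is the intersection of
the orderings above it. Applied to [E], it gives injectivity of [a |-> hat a]; applied to
[E[ab]], it shows that an element [c] lying in [D(a, b)] at every point of [Sper A] is a
sum of elements [a e] and [b e] with [e] in [E]. Since [a + a e = {a}], such elements are
absorbed by [a + b]; using this for [c] in [D(a, b)], [- a] in [D(b, - c)] and [- b] in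
[D(a, - c)], one finds that [D^t(a, b)] is the image of [a + b]. Thus (AX3) is
associativity in [A], and a set [P] as in (AX2) is the positive cone of a morphism. *)
Require Import Defs.
From mathcomp Require Import ssreflect ssrfun ssrbool.
From mathcomp Require Import boolp classical_sets.

Set Implicit Arguments.
Unset Strict Implicit.
Unset Printing Implicit Defensive.

Arguments madd_rev {m x y z}.
Arguments madd_0 {m x y}.
Arguments madd_assoc {m x y w t}.
Arguments madd_comm {m x y z}.
Arguments mmul_assoc {m}.
Arguments mmul_comm {m}.
Arguments mmul_1 {m}.
Arguments mmul_0 {m}.
Arguments mmul_distr {m a b c}.

Declare Scope multiring_scope.
Local Open Scope multiring_scope.
Local Notation "x * y" := (mmul x y) : multiring_scope.
Local Notation "- x" := (mopp x) : multiring_scope.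
Local Notation "0" := mzero : multiring_scope.
Local Notation "1" := mone : multiring_scope.

(** * Computing in a multiring *)

Lemma mmulCA (A : multiring) (a b c : A) : a * (b * c) = b * (a * c).
Proof. by rewrite !mmul_assoc (mmul_comm a). Qed.

Lemma mmulAC (A : multiring) (a b c : A) : (a * b) * c = (a * c) * b.
Proof. by rewrite -!mmul_assoc (mmul_comm b). Qed.

Lemma mmulACA (A : multiring) (a b c d : A) : (a * b) * (c * d) = (a * c) * (b * d).
Proof. by rewrite !mmul_assoc (mmulAC a). Qed.

Lemma mmulx1 (A : multiring) (a : A) : a * 1 = a.
Proof. by rewrite mmul_comm mmul_1. Qed.

Lemma mmul0x (A : multiring) (a : A) : 0 * a = 0.
Proof. by rewrite mmul_comm mmul_0. Qed.

Lemma madd0x (A : multiring) (x : A) : madd 0 x x.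
Proof. exact/madd_0. Qed.

Lemma maddx0 (A : multiring) (x : A) : madd x 0 x.
Proof. exact/madd_comm/madd0x. Qed.

Lemma maddxN (A : multiring) (x : A) : madd x (- x) 0.
Proof. by have [] := madd_rev (madd0x x). Qed.

Lemma madd_eq0 (A : multiring) (x y : A) : madd x y 0 -> y = - x.
Proof. by move=> /madd_rev[_ /madd_comm/madd_0]. Qed.

Lemma moppK (A : multiring) (x : A) : - - x = x.
Proof. by rewrite -(@madd_eq0 _ (- x) x)//; apply/madd_comm/maddxN. Qed.

Lemma mmulNx (A : multiring) (x y : A) : (- x) * y = - (x * y).
Proof.
apply: madd_eq0; rewrite -[X in madd _ _ X](mmul0x y).
exact/mmul_distr/maddxN.
Qed.

Lemma mmulxN (A : multiring) (x y : A) : x * (- y) = - (x * y).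
Proof. by rewrite mmul_comm mmulNx mmul_comm. Qed.

Lemma mmulNN (A : multiring) (x y : A) : (- x) * (- y) = x * y.
Proof. by rewrite mmulNx mmulxN moppK. Qed.

Lemma mopp0 (A : multiring) : - (0 : A) = 0.
Proof. by rewrite -(madd_eq0 (madd0x 0)). Qed.

Lemma maddBr (A : multiring) (x y z : A) : madd x y z -> madd z (- y) x.
Proof. by move=> /madd_rev[]. Qed.

Lemma maddBl (A : multiring) (x y z : A) : madd x y z -> madd z (- x) y.
Proof. by move=> /madd_comm/maddBr. Qed.

Lemma maddN (A : multiring) (x y z : A) : madd x y z -> madd (- x) (- y) (- z).
Proof.
move=> /(mmul_distr (mopp 1)).
by rewrite !mmulxN !mmulx1.
Qed.

Lemma mmul_distl (A : multiring) (a b c d : A) :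
  madd a b c -> madd (d * a) (d * b) (d * c).
Proof. by rewrite !(mmul_comm d); exact: mmul_distr. Qed.

Lemma madd_split_r (A : multiring) (x y y1 y2 z : A) :
  madd x y z -> madd y1 y2 y -> exists2 w, madd x y1 w & madd w y2 z.
Proof.
move=> xyz y12.
have /madd_assoc[w []] : exists y, madd y1 y2 y /\ madd x y z by exists y.
by exists w.
Qed.

Lemma madd_split_l (A : multiring) (x y x1 x2 z : A) :
  madd x y z -> madd x1 x2 x -> exists2 w, madd x2 y w & madd x1 w z.
Proof.
move=> xyz x12.
have /madd_assoc[w []] : exists x, madd x1 x2 x /\ madd x y z by exists x.
by exists w.
Qed.

Lemma madd_interchange (A : multiring) (a b c d x y z : A) :
  madd a b x -> madd c d y -> madd x y z ->
  exists p q, [/\ madd a c p, madd b d q & madd p q z].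
Proof.
move=> abx cdy xyz.
have [w byw awz] := madd_split_l xyz abx.
have [v /madd_comm bcv vdw] := madd_split_r byw cdy.
have [q bdq cqw] := madd_split_l vdw bcv.
have [p acp pqz] := madd_split_r awz cqw.
by exists p, q.
Qed.

(** * Preorderings and orderings *)

Inductive cone (A : multiring) (S : A -> Prop) : A -> Prop :=
| cone_gen x : S x -> cone S x
| cone_add x y z : cone S x -> cone S y -> madd x y z -> cone S z.

Definition add_closed (A : multiring) (T : A -> Prop) : Prop :=
  forall x y z, T x -> T y -> madd x y z -> T z.

Definition mul_closed (A : multiring) (T : A -> Prop) : Prop :=
  forall x y, T x -> T y -> T (x * y).

Lemma cone_ind_add (A : multiring) (S U : A -> Prop) :
  add_closed U -> (forall x, S x -> U x) -> forall x, cone S x -> U x.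
Proof. by move=> Uadd SU x; elim=> [|y z t _ Uy _ Uz yzt]; [exact: SU|exact: Uadd yzt]. Qed.

Lemma cone_ind_mul (A : multiring) (S U : A -> Prop) (a : A) :
  add_closed U -> (forall x, S x -> U (a * x)) -> forall x, cone S x -> U (a * x).
Proof.
move=> Uadd; apply: (cone_ind_add (U := fun x => U (a * x))) => x y z Ux Uy.
by move=> /(mmul_distl a); exact: Uadd.
Qed.

(** For a preordering [T], [span T 1 d] is [T[d]], and [span T d d] consists of the sums of elements
    of [dT]. The additive closure is taken because distributivity is only an inclusion of [d(t + s)]
    in [dt + ds]. *)
Definition span (A : multiring) (T : A -> Prop) (a b : A) : A -> Prop :=
  cone (fun z => exists2 t, T t & z = a * t \/ z = b * t).

Lemma span_add (A : multiring) (T : A -> Prop) (a b : A) : add_closed (span T a b).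
Proof. exact: cone_add. Qed.
Arguments span_add {A T a b}.

Lemma span_l (A : multiring) (T : A -> Prop) (a b t : A) : T t -> span T a b (a * t).
Proof. by move=> Tt; apply: cone_gen; exists t => //; left. Qed.

Lemma span_r (A : multiring) (T : A -> Prop) (a b t : A) : T t -> span T a b (b * t).
Proof. by move=> Tt; apply: cone_gen; exists t => //; right. Qed.

Lemma span_ind_mul (A : multiring) (T U : A -> Prop) (a b c : A) :
  add_closed U -> (forall t, T t -> U (c * (a * t)) /\ U (c * (b * t))) ->
  forall x, span T a b x -> U (c * x).
Proof.
move=> Uadd TU; apply: (cone_ind_mul (U := U)) => // x [t Tt].
by have [? ?] := TU _ Tt; case=> ->.
Qed.

Definition preordering (A : multiring) (T : A -> Prop) : Prop :=
  [/\ add_closed T, mul_closed T & forall a, T (a * a)].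

Lemma preordering1 (A : multiring) (T : A -> Prop) : preordering T -> T 1.
Proof. by case=> _ _ /(_ 1); rewrite mmul_1. Qed.

Lemma preordering0 (A : multiring) (T : A -> Prop) : preordering T -> T 0.
Proof. by case=> _ _ /(_ 0); rewrite mmul_0. Qed.

Lemma sub_adjoin (A : multiring) (T : A -> Prop) (d t : A) : T t -> span T 1 d t.
Proof. by rewrite -{2}(mmul_1 t); exact: span_l. Qed.

Lemma mem_adjoin (A : multiring) (T : A -> Prop) (d : A) :
  preordering T -> span T 1 d d.
Proof. by move=> /preordering1 T1; rewrite -{2}(mmulx1 d); exact: span_r. Qed.

Lemma preordering_adjoin (A : multiring) (T : A -> Prop) (d : A) :
  preordering T -> preordering (span T 1 d).
Proof.
move=> [Tadd Tmul Tsq]; split; first exact: span_add.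
- have Tl t y : T t -> span T 1 d y -> span T 1 d (t * y).
    move=> Tt; apply: (span_ind_mul (U := span T 1 d)) => [|s Ts]; first exact: span_add.
    by split; rewrite mmulCA; [apply: span_l|apply: span_r]; exact: Tmul.
  move=> x y Sx Sy; rewrite mmul_comm.
  move: Sx; apply: (span_ind_mul (U := span T 1 d)) => [|t Tt]; first exact: span_add.
  rewrite mmul_1 (mmul_comm y); split; first exact: Tl.
  (* What is left is to multiply [y] by [d]; this sends [d s] to [(d d) s], which is in [T] as
     squares are. *)
  rewrite mmul_assoc mmul_comm; apply: Tl => //; rewrite mmul_comm.
  move: Sy; apply: (span_ind_mul (U := span T 1 d)) => [|s Ts]; first exact: span_add.
  rewrite mmul_1 mmul_assoc; split; first exact: span_r.
  by apply/sub_adjoin/Tmul.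
- by move=> a; exact/sub_adjoin.
Qed.

(** Sums are regrouped by [madd_interchange]: the terms in [T] merge into one element of [T], those
    in [dT] into one sum [w]. *)
Lemma adjoin_decomp (A : multiring) (T : A -> Prop) (d z : A) :
  preordering T -> span T 1 d z ->
  exists s w, [/\ T s, span T d d w & madd s w z].
Proof.
move=> pT; have [Tadd _ _] := pT; have T0 := preordering0 pT; move: z.
apply: cone_ind_add => [x y z [s [w [Ts Sw swx]]] [s' [w' [Ts' Sw' swy]]]|].
  move=> /(madd_interchange swx swy)[p [q [sp wq pqz]]].
  by exists p, q; split=> //; [exact: Tadd sp|exact: span_add wq].
move=> z [t Tt [|] ->].
  exists t, (d * 0); rewrite mmul_1 mmul_0; split => //.
  - by rewrite -(mmul_0 d); exact: span_l.
  - exact: maddx0.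
by exists 0, (d * t); split => //; [exact: span_l|exact: madd0x].
Qed.

(* Write [- w] in [e + s] and [- w'] in [e + s'], with [w], [w'] sums of elements of [xT]
   and [yT]: then [ww'] is in [- T], and in [e + T] by multiplying the two. *)
Lemma adjoin_proper (A : multiring) (T : A -> Prop) (e x y : A) :
  preordering T -> e * e = e -> T (- (x * y)) ->
  span T 1 x (- e) -> span T 1 y (- e) -> T (- e).
Proof.
move=> pT ee Txy; have [Tadd Tmul Tsq] := pT; have Te : T e by rewrite -ee.
move=> /(adjoin_decomp pT)[s [w [Ts Sw swe]]].
move=> /(adjoin_decomp pT)[s' [w' [Ts' Sw' swe']]].
have eN z r : madd z r (- e) -> madd e z (- r).
  by move=> /maddBr/maddBl; rewrite moppK => /madd_comm.
have /(mmul_distr (- w')) := eN _ _ swe; rewrite mmulNN => ww'.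
have /(mmul_distl e) ew' := eN _ _ swe'; rewrite ee in ew'.
have /(mmul_distl s) sw' := eN _ _ swe'.
(* Here [ww'] lies in [e + h] with [h] in [T], so [- e] lies in [h - ww']. *)
have [h es'h /maddBl/maddBl hww'] := madd_split_l ww' ew'.
apply: (Tadd) hww'.
  by apply: (Tadd) es'h; [|apply: (Tadd) sw']; exact: Tmul.
rewrite -mmulNx; apply: (span_ind_mul (U := T)) Sw' => // t Tt.
suff : T (- w * (y * t)) by [].
rewrite mmulNx -mmulxN mmul_comm; apply: (span_ind_mul (U := T)) Sw => // r Tr.
suff : T (- (y * t) * (x * r)) by [].
by rewrite mmul_comm mmulxN mmulACA -mmulNx; do 2?[apply: (Tmul)].
Qed.

(** * Points of the spectrum above a preordering *)

Lemma hatD (A : multiring) (a b c : A) (s : Sper A) :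
  madd a b c -> q2add (hat A a s) (hat A b s) (hat A c s).
Proof. by have [H _] := proj2_sig s; exact: H. Qed.

Lemma hatN (A : multiring) (a : A) (s : Sper A) : hat A (- a) s = sgn_opp (hat A a s).
Proof. by have [_ [H _]] := proj2_sig s; exact: H. Qed.

Lemma hat0 (A : multiring) (s : Sper A) : hat A 0 s = Szero.
Proof. by have [_ [_ []]] := proj2_sig s. Qed.

Lemma hatM (A : multiring) (a b : A) (s : Sper A) :
  hat A (a * b) s = sgn_mul (hat A a s) (hat A b s).
Proof. by have [_ [_ [_ [H _]]]] := proj2_sig s; exact: H. Qed.

Lemma hat1 (A : multiring) (s : Sper A) : hat A 1 s = Spos.
Proof. by have [_ [_ [_ []]]] := proj2_sig s. Qed.

Definition prime_support (A : multiring) (T : A -> Prop) : Prop :=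
  forall a b, T (a * b) -> T (- (a * b)) -> (T a /\ T (- a)) \/ (T b /\ T (- b)).

(** The morphism is the sign attached to [T]: zero on the support, positive on the rest of [T],
    negative off [T]. *)
Lemma ordering_point (A : multiring) (T : A -> Prop) :
  add_closed T -> mul_closed T -> (forall a, T a \/ T (- a)) -> ~ T (mopp 1) ->
  prime_support T ->
  exists s : Sper A, forall a, T a <-> sgn_ge0 (hat A a s).
Proof.
move=> Tadd Tmul Ttot TN1 Tprime.
pose f a := if `[< T a >] then if `[< T (- a) >] then Szero else Spos else Sneg.
have T1 : T 1 by case: (Ttot 1).
have T0 : T 0 by case: (Ttot 0) => //; rewrite mopp0.
have fmor : is_morphism_Q2 A f.
  split=> [a b c abc|].
    (* With totality, these closure facts about [a], [b], [c] and their opposites make every sign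
       case propositional. *)
    have h1 : T a -> T b -> T c by move=> ? ?; exact: Tadd abc.
    have h2 : T (- a) -> T (- b) -> T (- c) by move=> ? ?; exact: Tadd (maddN abc).
    have h3 : T c -> T (- a) -> T b by move=> ? ?; exact: Tadd (maddBl abc).
    have h4 : T c -> T (- b) -> T a by move=> ? ?; exact: Tadd (maddBr abc).
    have h5 : T (- c) -> T a -> T (- b).
      by move=> ? ?; apply: (Tadd) (maddBl (maddN abc)) => //; rewrite moppK.
    have h6 : T (- c) -> T b -> T (- a).
      by move=> ? ?; apply: (Tadd) (maddBr (maddN abc)) => //; rewrite moppK.
    have := Ttot a; have := Ttot b; have := Ttot c.
    by rewrite /f; do ![case: asboolP => ?] => /=; tauto.
  split=> [a|].
    have := Ttot a.
    by rewrite /f moppK; do ![case: asboolP => ?] => /=; tauto.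
  split; first by rewrite /f mopp0 (asboolT T0).
  split=> [a b|]; last by rewrite /f (asboolT T1) (asboolF TN1).
  have h1 : T a -> T b -> T (a * b) by exact: Tmul.
  have h2 : T (- a) -> T b -> T (- (a * b)) by rewrite -mmulNx; exact: Tmul.
  have h3 : T a -> T (- b) -> T (- (a * b)) by rewrite -mmulxN; exact: Tmul.
  have h4 : T (- a) -> T (- b) -> T (a * b).
    by move=> ? ?; rewrite -mmulNN; exact: Tmul.
  have := Ttot a; have := Ttot b; have := Tprime a b.
  by rewrite /f; do ![case: asboolP => ?] => /=; tauto.
exists (exist _ f fmor) => a; have := Ttot a; rewrite /hat /= /f /sgn_ge0.
by do ![case: asboolP => ?]; intuition.
Qed.

Lemma maximal_preordering (A : multiring) (T : A -> Prop) (e : A) :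
  preordering T -> ~ T (- e) ->
  exists M : A -> Prop, [/\ preordering M, forall x, T x -> M x, ~ M (- e) &
    forall x, ~ M x -> span M 1 x (- e)].
Proof.
move=> pT Te.
pose good (X : set A) := [/\ preordering X, forall x, T x -> X x & ~ X (- e)].
have [F FP Ftot|M [PM Mmax]] := @Zorn_bigcup A (fun X => X = set0 \/ good X).
  have [[X0 FX0 gX0]|nF] := pselect (exists2 X, F X & good X); last first.
    left; rewrite -subset0 => x [X FX Xx].
    have [X00|gX] := FP _ FX; first by rewrite X00 in Xx.
    by case: nF; exists X.
  have Fgood X x : F X -> X x -> good X.
    by move=> FX Xx; have [X00|//] := FP _ FX; rewrite X00 in Xx.
  have common x y : (\bigcup_(X in F) X)%classic x -> (\bigcup_(X in F) X)%classic y ->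
      exists X, [/\ F X, good X, X x & X y].
    move=> [X FX Xx] [Y FY Yy].
    have [XY|YX] := Ftot _ _ FX FY.
      by exists Y; split=> //; [exact: Fgood Yy|exact: XY].
    by exists X; split=> //; [exact: Fgood Xx|exact: YX].
  right; split; [split|..].
  - move=> x y z /common + /[dup] => /[apply] -[X [FX [[Xadd _ _] _ _] Xx Xy]] _ xyz.
    by exists X => //; exact: Xadd xyz.
  - move=> x y /common/[apply] -[X [FX [[_ Xmul _] _ _] Xx Xy]].
    by exists X => //; exact: Xmul.
  - by move=> a; exists X0 => //; case: gX0 => -[].
  - by move=> x Tx; exists X0 => //; case: gX0 => _ + _; apply.
  - by move=> [X FX Xe]; have [_ _] := Fgood _ _ FX Xe.
have gM : good M.
  case: PM => // M0; case: (Mmax T); last by right.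
  split=> [|TM]; first by rewrite M0; exact: sub0set.
  by have := TM _ (preordering1 pT); rewrite M0.
have [pM TM Me] := gM; exists M; split=> // x Mx.
apply: contrapT => nxe; apply: (Mmax (span M 1 x)).
  split=> [y My|/(_ x (mem_adjoin _ pM))//]; exact: sub_adjoin.
right; split=> //; first exact: preordering_adjoin.
by move=> y /TM; exact: sub_adjoin.
Qed.

(** Let [M] be maximal above [T] avoiding [- e]. By [adjoin_proper], [- xy] in [M] forces [x] or [y]
    into [M]; the case [y = - x] is totality. As [- e] is not in [M], [e] is positive at the
    resulting point. *)
Lemma preordering_point (A : multiring) (T : A -> Prop) (e : A) :
  preordering T -> e * e = e -> ~ T (- e) ->
  exists s : Sper A, (forall t, T t -> sgn_ge0 (hat A t s)) /\ hat A e s = Spos.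
Proof.
move=> pT ee /(maximal_preordering pT)[M [pM TM Me Mmax]].
have [Madd Mmul Msq] := pM.
have Mprod x y : M (- (x * y)) -> M x \/ M y.
  move=> Mxy; have [Mx|/Mmax xe] := pselect (M x); first by left.
  right; apply: contrapT => /Mmax ye; exact/Me/(adjoin_proper pM ee Mxy).
have Mtot x : M x \/ M (- x).
  by apply: Mprod; rewrite mmulxN moppK.
have [||s sP] := ordering_point Madd Mmul Mtot.
- by move=> M1; apply: Me; rewrite -(mmul_1 e) -mmulNx -ee; exact: Mmul.
- move=> x y Mxy MNxy.
  (* The four sign choices together give prime support. *)
  have := Mprod x y; have := Mprod (- x) y; have := Mprod x (- y).
  have := Mprod (- x) (- y).
  rewrite !mmulNx !mmulxN !moppK.
  move=> /(_ MNxy) ? /(_ Mxy) ? /(_ Mxy) ? /(_ MNxy) ?; tauto.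
- exists s; split=> [t /TM/sP//|].
  have : ~ sgn_ge0 (hat A (- e) s) by move/sP.
  by rewrite hatN /sgn_ge0; case: (hat A e s) => //=; tauto.
Qed.

(** * Real reduced multirings *)

Lemma mul_sqK (A : multiring) : real_reduced A -> forall a : A, a * (a * a) = a.
Proof. by case=> _ []. Qed.

Lemma idem_sq (A : multiring) : real_reduced A ->
  forall a : A, (a * a) * (a * a) = a * a.
Proof. by move=> /mul_sqK aK a; rewrite -mmul_assoc aK. Qed.

Lemma add_absorb (A : multiring) : real_reduced A ->
  forall a e c : A, e * e = e -> madd a (a * e) c -> c = a.
Proof. by move=> [_ [_ [H _]]] a e c ee; rewrite -ee; exact: H. Qed.

Lemma add_same (A : multiring) : real_reduced A ->
  forall a c : A, madd a a c -> c = a.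
Proof.
by move=> hA a c aac; apply: (add_absorb hA (mmul_1 1)); rewrite mmulx1.
Qed.

Lemma idem_add_uniq (A : multiring) : real_reduced A ->
  forall e f c d : A, e * e = e -> f * f = f ->
  madd e f c -> madd e f d -> c = d.
Proof. by move=> [_ [_ [_ H]]] e f c d <- <-; exact: H. Qed.

(** Multiplying by [e] puts [ce] in [e + ef], which is [{e}]. *)
Lemma idem_add_mull (A : multiring) : real_reduced A ->
  forall e f c : A, e * e = e -> f * f = f -> madd e f c -> c * e = e.
Proof.
move=> hA e f c ee ff /(mmul_distr e); rewrite ee (mmul_comm f).
exact: add_absorb.
Qed.

(** As [ce = e] and [cf = f], also [cc] lies in [e + f], which is a singleton. *)
Lemma idem_add (A : multiring) : real_reduced A ->
  forall e f c : A, e * e = e -> f * f = f -> madd e f c -> c * c = c.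
Proof.
move=> hA e f c ee ff efc; apply: (idem_add_uniq hA ee ff) => //.
have /(mmul_distl c) := efc.
by rewrite (idem_add_mull hA ee ff efc) (idem_add_mull hA ff ee)//; exact/madd_comm.
Qed.

Lemma preordering_idem (A : multiring) : real_reduced A ->
  preordering (fun e : A => e * e = e).
Proof.
move=> hA; split=> [e f c ee ff||a]; first exact: idem_add.
- by move=> e f ee ff; rewrite mmulACA ee ff.
- exact: idem_sq.
Qed.

(** No point has [e = 1] and [- f] nonnegative, so [- e] lies in [E[- f]]. Thus [e + s] contains
    some [m = - w] that is a sum of elements of [fE]; then [mf = m] and [me = e], whence
    [ef = e]. *)
Lemma idem_le (A : multiring) : real_reduced A ->
  forall e f : A, e * e = e -> f * f = f ->
  (forall s : Sper A, hat A e s = Spos -> hat A f s = Spos) -> e * f = e.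
Proof.
move=> hA e f ee ff ef; have pE := preordering_idem hA; have [Eadd _ _] := pE.
have [|/(preordering_point (preordering_adjoin _ pE) ee)[s [sE se]]] :=
    pselect (span (fun e : A => e * e = e) 1 (- f) (- e)); last first.
  have := sE _ (mem_adjoin _ pE); rewrite hatN ef//=.
  by case.
move=> /(adjoin_decomp pE)[s [w [ss Sw /maddBl/maddN]]]; rewrite !moppK => esw.
have [mm mf] : (- w) * (- w) = - w /\ (- w) * f = - w.
  move: w Sw {esw}; apply: (cone_ind_add (U := fun w => _ /\ _)).
    move=> x y z [xx xf] [yy yf] /maddN xyz; split; first exact: Eadd xyz.
    apply: (idem_add_uniq hA xx yy) => //.
    by have := mmul_distr f xyz; rewrite xf yf.
  move=> x [t tt xE]; have -> : - x = f * t by case: xE => ->; rewrite mmulNx moppK.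
  by rewrite mmulACA ff tt mmulAC ff.
have em := idem_add_mull hA ee ss esw.
by rewrite -em mmulAC mf.
Qed.

(* [v] lies in [u^2 - v^2], which is contained in [u^2 + t - q]; so [v = v' - q] with
   [v'] and [q] both in [T], and [v] is a sum of [v v'^2] and [v q^2]. *)
Lemma mem_of_sq_add (A : multiring) : real_reduced A ->
  forall (T : A -> Prop) (v t q : A), preordering T ->
  T t -> madd (v * v) t q -> T (v * q) -> T v.
Proof.
move=> hA T v t q [Tadd Tmul Tsq] Tt vtq Tvq.
have Tq : T q by exact: Tadd vtq.
(* For [u] in [v + v^2], both [vu] and [v^2 u] lie in [v^2 + v]; as [x + x = {x}], so does their sum
   [u^2]. *)
have [u vu] := madd_nonempty _ v (v * v).
have u2 : madd (v * v) v (u * u).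
  have /(mmul_distl v) := vu; rewrite mul_sqK// => vvu.
  have /(mmul_distl (v * v)) := vu.
  rewrite (mmul_comm (v * v) v) mul_sqK// idem_sq// => /madd_comm vvvu.
  have [x [y [/(add_same hA)-> /(add_same hA)->]]//] :=
    madd_interchange vvu vvvu (mmul_distr u vu).
have /maddBr/maddN : madd (v * v) t q by [].
rewrite moppK => /madd_comm tq.
have [v' uv' v'q] := madd_split_r (maddBl u2) tq.
have Tv' : T v' by exact: Tadd uv'.
have /(mmul_distl v) := maddBr v'q; rewrite moppK => vv'.
have Tvv' : T (v * v') by apply: (Tadd) vv'.
(* Where [v] is nonzero, [v'] or [q] is nonzero, so [k] is 1 there. *)
have [k v'qk] := madd_nonempty _ (v' * v') (q * q).
have vk : (v * v) * k = v * v.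
  apply: (idem_le hA); first exact: idem_sq.
    by apply: idem_add v'qk => //; exact: idem_sq.
  move=> s; move: (hatD s v'qk) (hatD s v'q); rewrite !hatM hatN.
  by case: (hat A v s) (hat A v' s) (hat A q s) (hat A k s) => [] [] [] [].
have -> : v = v * k by rewrite -{2}(mul_sqK hA v) -mmul_assoc vk mul_sqK.
by apply: (Tadd) (mmul_distl v v'qk); rewrite mmul_assoc; exact: Tmul.
Qed.

(** The Nichtnegativstellensatz. No point nonnegative on [T[- v]] has [v^2 = 1], so [- v^2] lies in
    [T[- v]]. This gives [q] in [v^2 + t] with [vq] in [T], and [mem_of_sq_add] removes the
    denominator [q]. *)
Lemma mem_preorderingP (A : multiring) : real_reduced A ->
  forall (T : A -> Prop) (v : A), preordering T ->
  (forall s : Sper A, (forall t, T t -> sgn_ge0 (hat A t s)) -> sgn_ge0 (hat A v s)) ->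
  T v.
Proof.
move=> hA T v pT vge0; have [Tadd Tmul Tsq] := pT.
have [|/(preordering_point (preordering_adjoin _ pT) (idem_sq hA v))[s [sT sv]]] :=
    pselect (span T 1 (- v) (- (v * v))); last first.
  have := sT _ (mem_adjoin _ pT).
  have : sgn_ge0 (hat A v s) by apply: vge0 => t Tt; exact/sT/sub_adjoin.
  move: sv; rewrite hatN hatM /sgn_ge0.
  by case: (hat A v s) => //= _; intuition.
move=> /(adjoin_decomp pT)[t [w [Tt Sw /maddBl/maddN]]]; rewrite !moppK => vtw.
apply: (mem_of_sq_add hA pT Tt vtw); rewrite mmulxN -mmulNx.
apply: (span_ind_mul (U := T)) Sw => // r Tr.
have : T (- v * (- v * r)) by rewrite mmul_assoc; exact: Tmul.
by [].
Qed.

(** Comparing idempotents gives [a^2 = b^2]. As [ab] is nonnegative everywhere, it is idempotent, so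
    [ab = a^2 b^2 = a^2], and [a = a^2 b = b]. *)
Lemma hat_inj (A : multiring) : real_reduced A ->
  forall a b : A, (forall s, hat A a s = hat A b s) -> a = b.
Proof.
move=> hA a b ab.
have aabb : a * a = b * b.
  have le c d : (forall s, hat A c s = hat A d s) -> (c * c) * (d * d) = c * c.
    move=> cd; apply: (idem_le hA); [exact: idem_sq|exact: idem_sq|].
    by move=> s; rewrite !hatM cd.
  by rewrite -(le a b)// -[RHS](le b a)// mmul_comm.
have /= idem_ab : (a * b) * (a * b) = a * b.
  apply: (mem_preorderingP hA (preordering_idem hA)) => s _.
  by rewrite hatM ab /sgn_ge0; case: (hat A b s) => /=; intuition.
have {}idem_ab : a * b = a * a.
  by rewrite -idem_ab mmulACA -aabb idem_sq.
by rewrite -[LHS](mul_sqK hA a) -idem_ab mmul_assoc aabb mmul_comm mul_sqK.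
Qed.

(** Where [ab] is nonnegative, so are [ac] and [bc]; hence both lie in [E[ab]]. *)
Lemma mem_spanP (A : multiring) : real_reduced A ->
  forall a b c : A,
  (forall s, sgn_mul (hat A a s) (hat A c s) = Spos \/
             sgn_mul (hat A b s) (hat A c s) = Spos \/ hat A c s = Szero) ->
  span (fun e : A => e * e = e) a b c.
Proof.
move=> hA a b c abc; have pE := preordering_idem hA; have [_ Emul _] := pE.
set E := fun e : A => e * e = e.
have pT := preordering_adjoin (a * b) pE.
have [Tac Tbc] : span E 1 (a * b) (a * c) /\ span E 1 (a * b) (b * c).
  split; apply: (mem_preorderingP hA pT) => s /(_ _ (mem_adjoin _ pE));
    move: (abc s); rewrite /sgn_ge0 !hatM;
    by case: (hat A a s) (hat A b s) (hat A c s) => [] [] [] /=; intuition.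
(* Where [c] is nonzero, [a] or [b] is nonzero, so [k] is 1 and [c = ck] lies in [a(ac) + b(bc)]. *)
have [k abk] := madd_nonempty _ (a * a) (b * b).
have -> : c = c * k.
  apply: (hat_inj hA) => s; move: (abc s) (hatD s abk); rewrite !hatM.
  by case: (hat A a s) (hat A b s) (hat A c s) (hat A k s) => [] [] [] []/=; intuition.
apply: span_add (mmul_distl c abk); rewrite mmulCA (mmul_comm c).
(* The generators [t] and [abt] of [E[ab]], multiplied by [a], become [at] and [b(a^2 t)]. *)
- apply: (span_ind_mul (U := span E a b)) Tac => [|t Et]; first exact: span_add.
  rewrite mmul_1; split; first exact: span_l.
  by rewrite -mmul_assoc (mmul_assoc a a) mmulCA; apply/span_r/Emul => //; exact: idem_sq.
- apply: (span_ind_mul (U := span E a b)) Tbc => [|t Et]; first exact: span_add.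
  rewrite mmul_1; split; first exact: span_r.
  rewrite -mmul_assoc mmulCA; apply/span_l; rewrite mmul_assoc.
  by apply: Emul => //; exact: idem_sq.
Qed.

(** Summands of [z] are absorbed one at a time: [ae] disappears into [a], and [be] into [b]. *)
Lemma span_absorb (A : multiring) : real_reduced A ->
  forall a b x y z : A, span (fun e : A => e * e = e) a b z ->
  madd a b x -> madd x z y -> madd a b y.
Proof.
move=> hA a b x y z Sz; move: z Sz x y.
apply: cone_ind_add => [z1 z2 z IH1 IH2 z12 x y abx xzy|].
  have [w xz1w wz2y] := madd_split_r xzy z12.
  by apply: IH2 wz2y; exact: IH1 xz1w.
move=> z [e ee zE] x y abx xzy.
case: zE => zE; rewrite {}zE in xzy.
  move: abx => /madd_comm abx; have [w aew bw] := madd_split_l xzy abx.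
  by apply/madd_comm; rewrite -(add_absorb hA ee aew).
have [w aew bw] := madd_split_l xzy abx.
by rewrite -(add_absorb hA ee aew).
Qed.

(* The set [a + b - c] absorbs [c], [- a] and [- b], hence contains [w - w] for each of
   its elements [w]. *)
Lemma maddP (A : multiring) : real_reduced A ->
  forall a b c : A,
  (forall s, q2add (hat A a s) (hat A b s) (hat A c s)) -> madd a b c.
Proof.
move=> hA a b c abc; set E := fun e : A => e * e = e.
have Sc : span E a b c.
  apply: (mem_spanP hA) => s; move: (abc s).
  by case: (hat A a s) (hat A b s) (hat A c s) => [] [] [] /=; intuition.
have Sa : span E b (- c) (- a).
  apply: (mem_spanP hA) => s; move: (abc s); rewrite !hatN.
  by case: (hat A a s) (hat A b s) (hat A c s) => [] [] [] /=; intuition.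
have Sb : span E a (- c) (- b).
  apply: (mem_spanP hA) => s; move: (abc s); rewrite !hatN.
  by case: (hat A a s) (hat A b s) (hat A c s) => [] [] [] /=; intuition.
pose W a b x := exists2 n, madd a b n & madd n (- c) x.
have WN a' b' x y : span E b' (- c) (- a') -> W a' b' x -> madd x (- a') y -> W a' b' y.
  move=> S [n abn ncx] xay.
  have [m bcm amx] := madd_split_l ncx abn.
  have [p map apy] := madd_split_l xay amx.
  exact: madd_split_r apy (span_absorb hA S bcm map).
have Wsym x a' b' : W a' b' x -> W b' a' x.
  by move=> [n /madd_comm abn ncx]; exists n.
have [n abn] := madd_nonempty _ a b.
have [w ncw] := madd_nonempty _ n (- c).
have Ww : W a b w by exists n.
(* Since [0] lies in [w - w], expanding [- w] as [- a - b + c] gives [w1] in [w - a - b] with [0] in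
   [w1 + c]. *)
have := maddN ncw; rewrite moppK => ncNw.
have [w1 wn w1c] := madd_split_r (maddxN w) ncNw.
have [w2 wa w2b] := madd_split_r wn (maddN abn).
have Ww2 : W a b w2 by apply: WN wa.
have [m abm /madd_comm mcw1] : W a b w1 by apply/Wsym; apply: WN w2b => //; exact: Wsym.
(* As [w1] lies in [m - c], this forces [c] into [m + c], and [a + b] absorbs [c]. *)
have [p mcp /madd_eq0] := madd_split_l w1c mcw1.
by rewrite moppK => <-; exact: span_absorb Sc abm mcp.
Qed.

(** * The real spectrum *)

(** On signs, the condition defining [Dtset] is exactly the sum of [Q_2]. *)
Lemma Dtset_hatP (A : multiring) : real_reduced A ->
  forall a b c : A, Dtset (Sper A) (hatA A) (hat A a) (hat A b) (hat A c) <-> madd a b c.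
Proof.
move=> hA a b c; split=> [[_ abc]|abc].
  apply: (maddP hA) => s; move: (abc s).
  by case: (hat A a s) (hat A b s) (hat A c s) => [] [] [] /=; intuition discriminate.
split; first by exists c.
move=> s; move: (hatD s abc).
by case: (hat A a s) (hat A b s) (hat A c s) => [] [] [] /=; intuition discriminate.
Qed.

(** Otherwise [1 = - 1], and [0] would lie in [1 + 1 = {1}]. *)
Lemma neg1_not_idem (A : multiring) : real_reduced A -> mopp 1 * mopp 1 <> mopp (1 : A).
Proof.
move=> hA; rewrite mmulNN mmul_1 => N1; case: hA (hA) => n10 _ hA.
by apply/n10/esym/(add_same hA); rewrite {2}N1; exact: maddxN.
Qed.

Lemma AX1_Sper (A : multiring) : real_reduced A -> AX1 (Sper A) (hatA A).
Proof.
move=> hA; split.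
  have [s _] := preordering_point (preordering_idem hA) (mmul_1 1) (neg1_not_idem hA).
  exact: inhabits s.
split; [split; [|split]|split].
- by exists (mopp 1); apply/funext => s; rewrite hatN hat1.
- by exists 0; apply/funext => s; rewrite hat0.
- by exists 1; apply/funext => s; rewrite hat1.
- by move=> _ _ [a ->] [b ->]; exists (a * b); apply/funext => s; rewrite hatM.
move=> [f pf] [g pg] fg; apply: contrapT => nsep; apply: fg.
apply/eq_exist/funext => a; apply: contrapT => fga; apply: nsep.
by exists (hat A a); split=> //; exists a.
Qed.

Lemma AX2_Sper (A : multiring) : real_reduced A -> AX2 (Sper A) (hatA A).
Proof.
move=> hA P PG P1 Pmul Ptot PN1 PD Pprime.
have hatME a b : hat A (a * b) = fmul (Sper A) (hat A a) (hat A b).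
  by apply/funext => s; rewrite hatM.
have hatNE a : hat A (- a) = fopp (Sper A) (hat A a).
  by apply/funext => s; rewrite hatN.
have G a : hatA A (hat A a) by exists a.
have [|||||s sP] := @ordering_point A (fun a => P (hat A a)).
(* Sums land in [Dtset], which is contained in [Dset]. *)
- move=> a b c Pa Pb abc; apply: (PD _ _ Pa Pb); split=> // s.
  by have /(Dtset_hatP hA)[_ /(_ s)] := abc; intuition.
- by move=> a b Pa Pb; rewrite hatME; exact: Pmul.
- by move=> a; rewrite hatNE; apply/Ptot.
- move=> PN; apply: PN1; suff <- : hat A (mopp 1) = fconst (Sper A) Sneg by [].
  by apply/funext => s; rewrite hatN hat1.
- by move=> a b; rewrite !hatNE hatME => ? ?; apply: Pprime.
exists s => g; split=> [Pg|[[a ->] ge0]]; last exact/sP.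
by split; first exact: PG; have [a ga] := PG _ Pg; move: Pg; rewrite ga => /sP.
Qed.

Lemma AX3_Sper (A : multiring) : real_reduced A -> AX3 (Sper A) (hatA A).
Proof.
move=> hA _ _ _ p [a ->] [b ->] [c ->] [q [bcq aqp]].
have [[q' qE] _] := bcq; have [[p' pE] _] := aqp.
move: bcq aqp; rewrite {}qE {}pE => /(Dtset_hatP hA) bcq /(Dtset_hatP hA) aqp.
have [r abr rcp] := madd_split_r aqp bcq.
by exists (hat A r); split; apply/(Dtset_hatP hA).
Qed.

Theorem theorem4p5 (A : multiring) (hA : real_reduced A) :
  is_ARS (Sper A) (hatA A).
Proof. by split; [exact: AX1_Sper|split; [exact: AX2_Sper|exact: AX3_Sper]]. Qed.
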